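(* Let $n\ge 1$, let $c\neq 0$ be a constant, and let $X$ be a random vector in $\mathbb{R}^n$ with $X\sim N(\mathbf{0},c^2\mathbf{I}_n)$. Define $\widehat{\ell}_1(X)=\ell_1(X)/\mathbb{E}(\ell_1(X))$ and $\widehat{\ell}_2(X)=\ell_2(X)/\mathbb{E}(\ell_2(X))$, where $\ell_1(X)=\|X\|_1$ and $\ell_2(X)=\|X\|_2$. Then $$\max\left\{\mathbf{Var}_X\!\left(\frac{\widehat{\ell}_2(X)}{\widehat{\ell}_1(X)}\right),\ \mathbf{Var}_X\!\left(\frac{\widehat{\ell}_1(X)}{\widehat{\ell}_2(X)}\right)\right\}\lesssim \frac{1}{n}.$$
   Context: $\mathbf{I}_n$ is the $n\times n$ identity matrix and $N(\mathbf{0},c^2\mathbf{I}_n)$ the centered isotropic Gaussian distribution. $\|\cdot\|_1$ and $\|\cdot\|_2$ are the $\ell_1$ and Euclidean norms. The symbol $A(n)\lesssim 1/n$ means that $A(n)$ is bounded above by a quantity of order $1/n$ (up to a multiplicative constant) as $n$ grows. *)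

(* Defs.v *)
From HB Require Import structures.
From mathcomp Require Import all_boot all_order all_algebra.
From mathcomp Require Import all_classical all_reals all_analysis.
Set Implicit Arguments. Unset Strict Implicit. Unset Printing Implicit Defensive.
Import Order.TTheory GRing.Theory Num.Theory.
Import numFieldNormedType.Exports.
Local Open Scope classical_set_scope.
Local Open Scope ring_scope.

(* The random vector X = (X_0,...,X_{n-1}) on the probability space P has law
   N(0, c^2 I_n): its joint law is the n-fold product of the one-dimensional
   normal law N(0,c^2), i.e. for all Borel sets B_0,...,B_{n-1},
   P(X_0 \in B_0, ..., X_{n-1} \in B_{n-1}) = prod_i N(0,c^2)(B_i).
   (Rectangles form a pi-system generating the Borel sets of R^n, so this
   determines the joint law.) *)
Definition isotropic_gaussian {R : realType} {d} {T : measurableType d}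
  (P : probability T R) (n : nat) (c : R) (X : 'I_n -> {RV P >-> R}) : Prop :=
  forall B : 'I_n -> set R, (forall i, measurable (B i)) ->
    P (\bigcap_(i in [set: 'I_n]) (X i @^-1` B i)) =
    (\prod_(i < n) normal_prob 0 c (B i))%E.

Definition ell1 {R : realType} {T : Type} (n : nat) (X : 'I_n -> T -> R) : T -> R :=
  fun w => \sum_(i < n) `|X i w|.
Definition ell2 {R : realType} {T : Type} (n : nat) (X : 'I_n -> T -> R) : T -> R :=
  fun w => Num.sqrt (\sum_(i < n) X i w ^+ 2).

Definition normalized {R : realType} {d} {T : measurableType d}
  (P : probability T R) (f : T -> R) : T -> R :=
  fun w => f w / fine ('E_P[f]).

(* Main.v *)
(** Write [U] for the mean of the [|X_i|] and [V] for their root mean square,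
    and [m = E |X_1|], [s^2 = E X_1^2].  The two normalized ratios are bounded
    multiples of [U / V] and [V / U], and a variance is at most the mean
    squared distance to any constant, here [m / s] and [s / m].  Pointwise
    these distances are controlled by [U - m] and [V^2 - s^2], whose second
    moments are [O(1/n)] because the summands are pairwise uncorrelated.
    For [V / U] this fails when [U] is below a small threshold, but there
    [(V / U)^2 <= n], and the event has probability at most [4^-n] since at
    least half of the [|X_i|] are small.  The argument applies to every law
    with a finite fourth moment and no atom at [0]; by scale invariance the
    normal law of variance [1] covers all [c]. *)

Require Import Defs.
From HB Require Import structures.
From mathcomp Require Import all_boot all_order all_algebra.
From mathcomp Require Import all_classical all_reals all_analysis.
From mathcomp Require Import measurable_realfun ring lra zify.
Set Implicit Arguments. Unset Strict Implicit. Unset Printing Implicit Defensive.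
Import Order.TTheory GRing.Theory Num.Theory.
Import numFieldNormedType.Exports.
Local Open Scope classical_set_scope.
Local Open Scope ring_scope.

Definition mse d (T : measurableType d) (R : realType) (P : probability T R)
    (f : T -> R) (a : R) : \bar R :=
  'E_P[(fun w => (f w - a) ^+ 2)%R].

Section mean_square.
Context d (T : measurableType d) (R : realType) (P : probability T R).
Implicit Types (f g h : T -> R) (a b k : R).

Lemma Lfun2_Lfun1 : {subset Lfun P 2%:E <= Lfun P 1}.
Proof. exact/Lfun_subset12/fin_num_measure. Qed.

Lemma Lfun2_sqr_Lfun1 f : f \in Lfun P 2%:E -> (fun w => f w ^+ 2) \in Lfun P 1.
Proof. by move=> f2; apply/Lfun1_integrable/Lfun2_integrable_sqr. Qed.

Lemma Lfun2_sqr_sub_Lfun1 f a : f \in Lfun P 2%:E ->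
  (fun w => (f w - a) ^+ 2) \in Lfun P 1.
Proof.
move=> f2; have fa2 : (f - cst a)%R \in Lfun P 2%:E.
  by rewrite rpredB ?lee1n// => *; exact: Lfun_cst.
exact: Lfun2_sqr_Lfun1 fa2.
Qed.

Lemma expectation_sqr_lty_Lfun2 f : measurable_fun setT f ->
  ('E_P[(fun w => f w ^+ 2)%R] < +oo)%E -> f \in Lfun P 2%:E.
Proof.
rewrite unlock => mf f2; rewrite inE; apply/andP; split; rewrite inE//=.
rewrite /finite_norm unlock poweR_lty//.
apply: le_lt_trans f2; under eq_integral => x _ do
  rewrite /= powR_mulrn// real_normK ?num_real//.
by [].
Qed.

Lemma Lfun_measurable (p : \bar R) f : f \in Lfun P p -> measurable_fun setT f.
Proof. by rewrite inE => /andP[/[1!inE]]. Qed.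

Lemma mse_expectation f : mse P f (fine 'E_P[f]) = 'V_P[f].
Proof. by rewrite /variance [in RHS]unlock. Qed.

Lemma variance_le_mse f a : measurable_fun setT f -> ('V_P[f] <= mse P f a)%E.
Proof.
move=> mf; have [mse_fin|] := ltP (mse P f a) +oo%E; last first.
  by rewrite leye_eq => /eqP ->; rewrite leey.
have fa2 : (f \- cst a)%R \in Lfun P 2%:E.
  by apply: expectation_sqr_lty_Lfun2 => //; exact: measurable_funB.
have f2 : f \in Lfun P 2%:E.
  have -> : f = ((f \- cst a) + cst a)%R by apply/funext => w; rewrite /= subrK.
  by rewrite rpredD ?lee1n// => *; exact: Lfun_cst.
rewrite -(varianceB_cst_r a f2) varianceE//.
rewrite leeBlDr ?fin_numX ?expectation_fin_num ?Lfun2_Lfun1//.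
by rewrite leeDl// sqre_ge0.
Qed.

Lemma mseZ f a k : measurable_fun setT f ->
  mse P (fun w => k * f w) (k * a) = ((k ^+ 2)%:E * mse P f a)%E.
Proof.
move=> mf; rewrite /mse unlock.
under eq_integral do rewrite -mulrBr exprMn EFinM.
rewrite ge0_integralZl ?lee_fin ?sqr_ge0//.
- by apply/measurable_EFinP/measurable_funX/measurable_funB.
- by move=> w _; rewrite lee_fin sqr_ge0.
Qed.

Lemma sqr_expectation_le f : f \in Lfun P 2%:E ->
  ('E_P[f] ^+ 2 <= 'E_P[(fun w => f w ^+ 2)%R])%E.
Proof.
move=> f2; have := variance_ge0 P f; rewrite varianceE// sube_ge0//.
by rewrite fin_numX// expectation_fin_num// Lfun2_Lfun1.
Qed.

Lemma Lfun1_lincomb f g a b : f \in Lfun P 1 -> g \in Lfun P 1 ->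
  (fun w => a * f w + b * g w) \in Lfun P 1.
Proof.
move=> f1 g1; have -> : (fun w => a * f w + b * g w) = (a \o* f) + (b \o* g).
  by apply/funext => w; rewrite /= mulrC (mulrC b).
by rewrite rpredD// Lfun_scale.
Qed.

Lemma expectation_lincomb f g a b : f \in Lfun P 1 -> g \in Lfun P 1 ->
  ('E_P[(fun w => a * f w + b * g w)%R] =
   a%:E * 'E_P[f] + b%:E * 'E_P[g])%E.
Proof.
move=> f1 g1; rewrite -!expectationZl// -expectationD ?Lfun_scale//.
by congr expectation; apply/funext => w; rewrite /= mulrC (mulrC b).
Qed.

Lemma le_expectation_lincomb f g h a b : f \in Lfun P 1 -> g \in Lfun P 1 ->
  measurable_fun setT h -> (forall w, 0 <= h w) ->
  (forall w, h w <= a * f w + b * g w) ->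
  ('E_P[h] <= a%:E * 'E_P[f] + b%:E * 'E_P[g])%E.
Proof.
move=> f1 g1 mh h0 hle; rewrite -expectation_lincomb//.
apply: expectation_le => //; last exact: aeW.
- exact: Lfun_measurable (Lfun1_lincomb a b f1 g1).
- by move=> w; exact: le_trans (hle w).
Qed.

Lemma covariance_sumr (I : Type) (r : seq I) f (g : I -> T -> R) :
  f \in Lfun P 2%:E -> (forall i, g i \in Lfun P 2%:E) ->
  covariance P f (\sum_(i <- r) g i) = (\sum_(i <- r) covariance P f (g i))%E.
Proof.
move=> f2 g2; elim: r => [|i r IHr]; first by rewrite !big_nil covariance_cst_r.
by rewrite !big_cons covarianceDr ?IHr//= rpred_sum ?lee1n.
Qed.

Lemma variance_sum (I : eqType) (r : seq I) (f : I -> T -> R) : uniq r ->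
  (forall i, f i \in Lfun P 2%:E) ->
  {in r &, forall i j, i != j -> covariance P (f i) (f j) = 0%E} ->
  'V_P[\sum_(i <- r) f i] = (\sum_(i <- r) 'V_P[f i])%E.
Proof.
move=> + f2; elim: r => [|i r IHr] /=; first by rewrite !big_nil variance_cst.
move=> /andP[ir ur] cov0; rewrite !big_cons varianceD ?rpred_sum ?lee1n//.
have -> : covariance P (f i) (\sum_(j <- r) f j) = 0%E.
  rewrite covariance_sumr// big_seq big1// => j jr.
  by rewrite cov0 ?inE ?eqxx ?jr ?orbT//; apply: contraNneq ir => ->.
rewrite mule0 adde0 IHr// => j k jr kr.
by apply: cov0; rewrite inE ?jr ?kr orbT.
Qed.

End mean_square.

Lemma normalizedZ d (T : measurableType d) (R : realType) (P : probability T R)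
    (f : T -> R) (k : R) : 0 < k -> measurable_fun setT f ->
  (forall w, 0 <= f w) -> normalized P (fun w => k * f w) = normalized P f.
Proof.
move=> k0 mf f0; have -> : normalized P (fun w => k * f w) =
    (fun w => k * f w / (k * fine 'E_P[f])).
  rewrite /normalized unlock; under eq_integral do rewrite EFinM.
  rewrite ge0_integralZl ?lee_fin ?(ltW k0)//; last 2 first.
  - exact/measurable_EFinP.
  - by move=> w _; rewrite lee_fin.
  by case: (integral _ _ _) => [r| |]//=; rewrite ?gt0_muley ?gt0_muleNy ?mulr0.
apply/funext => w.
by rewrite invfM mulrACA divff ?mul1r// gt_eqF.
Qed.

Lemma probability_le_right_lt d (T : measurableType d) (R : realType)
    (P : probability T R) (f : T -> R) (a e : R) : measurable_fun setT f ->
  (P [set w | (f w <= a)%R] < e%:E)%E ->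
  exists2 t, a < t & (P [set w | (f w <= t)%R] < e%:E)%E.
Proof.
move=> mf fa; pose X : {RV P >-> R} := mfun_Sub (mem_set mf).
have cdfE t : P [set w | f w <= t] = cdf X t.
  by rewrite /cdf /distribution /pushforward set_itvNyc.
rewrite cdfE in fa.
have cdf_near : \forall t \near a^'+, (cdf X t < e%:E)%E.
  exact: cdf_right_continuous (open_ereal_lt' fa).
have [t [a_lt_t cdf_t]] : exists t, a < t /\ (cdf X t < e%:E)%E.
  near a^'+ => t; exists t; split; near: t => //; exact: nbhs_right_gt.
by exists t; rewrite ?cdfE.
Unshelve. all: by end_near. Qed.

Lemma measurable_funV d (T : measurableType d) (R : realType) (f : T -> R) :
  measurable_fun setT f -> measurable_fun setT (fun w => (f w)^-1).
Proof.
move=> mf; have -> : (fun w => (f w)^-1) = (fun w => f w * (f w ^+ 2) `^ (-1)).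
  apply/funext => w; rewrite powR_inv1 ?sqr_ge0//.
  have [->|f0] := eqVneq (f w) 0; first by rewrite mul0r invr0.
  by field.
apply: measurable_funM => //.
by apply: (measurableT_comp (measurable_powR _)); exact: measurable_funX.
Qed.

Definition sample_mean (R : realFieldType) (n : nat) (x : 'I_n -> R) : R :=
  (\sum_(i < n) x i) / n%:R.

Lemma sqr_sample_mean_le (R : realFieldType) (n : nat) (x : 'I_n -> R) :
  sample_mean x ^+ 2 <= sample_mean (fun i => x i ^+ 2).
Proof.
case: n x => [|n] x; first by rewrite /sample_mean !big_ord0 mul0r expr0n.
have N0 : n.+1%:R != 0 :> R by rewrite pnatr_eq0.
rewrite -subr_ge0.
have -> : sample_mean (fun i => x i ^+ 2) - sample_mean x ^+ 2 =
    sample_mean (fun i => (x i - sample_mean x) ^+ 2).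
  rewrite {1 3}/sample_mean; set a := sample_mean x.
  have sumE : \sum_(i < n.+1) x i = a * n.+1%:R by rewrite mulfVK.
  under [in RHS]eq_bigr do rewrite sqrrB.
  rewrite big_split/= sumr_const card_ord sumrB sumrMnl -mulr_suml sumE.
  by rewrite -[_ *+ n.+1]mulr_natr -[_ *+ 2]mulr_natr; field.
by rewrite divr_ge0// sumr_ge0// => i _; rewrite sqr_ge0.
Qed.

Lemma sample_mean_sqr_le (R : realFieldType) (n : nat) (x : 'I_n -> R) :
  (forall i, 0 <= x i) ->
  sample_mean (fun i => x i ^+ 2) <= n%:R * sample_mean x ^+ 2.
Proof.
move=> x0; have [N0|N0] := eqVneq (n%:R : R) 0.
  by rewrite /sample_mean N0 invr0 !mulr0 mul0r.
have -> : n%:R * sample_mean x ^+ 2 = (\sum_(i < n) x i) ^+ 2 / n%:R.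
  by rewrite /sample_mean; field.
rewrite ler_wpM2r ?invr_ge0// expr2 mulr_suml; apply: ler_sum => i _.
by rewrite expr2 ler_wpM2l// (bigD1 i)//= lerDl sumr_ge0.
Qed.

Lemma sample_mean_lt_card (R : realFieldType) (n : nat) (x : 'I_n -> R) t :
  (forall i, 0 <= x i) -> sample_mean x < t ->
  (n <= 2 * #|[set i | (x i <= 2 * t)%R]%SET|)%N.
Proof.
move=> x0; set S := [set i | _]%SET; apply: contraTT.
rewrite -ltnNge -leNgt => nS.
have n0 : 0 < n%:R :> R by rewrite ltr0n (leq_ltn_trans _ nS).
have [t_le0|t0] := leP t 0.
  by rewrite (le_trans t_le0)// divr_ge0 ?sumr_ge0 ?ltW.
rewrite ler_pdivlMr//; apply: (@le_trans _ _ (\sum_(i in ~: S) 2 * t)).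
  rewrite sumr_const -[leRHS]mulr_natl mulrC mulrA.
  rewrite ler_wpM2r ?ltW// -natrM ltr_nat.
  have := cardsC S; rewrite card_ord; lia.
rewrite [leRHS](bigID (mem (~: S)%SET)) /= -[leLHS]addr0 lerD ?sumr_ge0//.
by apply: ler_sum => i; rewrite !inE -ltNge => /ltW.
Qed.

Lemma sqrrD_le2 (R : realDomainType) (x y : R) :
  (x + y) ^+ 2 <= 2 * x ^+ 2 + 2 * y ^+ 2.
Proof. by have := sqr_ge0 (x - y); rewrite sqrrB sqrrD; lra. Qed.

Section ratio_bounds.
Context (R : realFieldType).
Implicit Types U V m s t N : R.

Lemma sqr_sub_le_sqr_sub V s : 0 <= V -> 0 < s ->
  (V - s) ^+ 2 <= (V ^+ 2 - s ^+ 2) ^+ 2 / s ^+ 2.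
Proof.
move=> V0 s0; rewrite ler_pdivlMr ?exprn_gt0// subr_sqr exprMn.
rewrite ler_wpM2l ?sqr_ge0//.
by rewrite lerXn2r ?nnegrE ?addr_ge0 ?lerDr// ltW.
Qed.

Lemma sqr_ratio_sub_le U V m s : 0 <= U -> U <= V -> 0 < s ->
  (U / V - m / s) ^+ 2 <=
  2 / s ^+ 4 * (V ^+ 2 - s ^+ 2) ^+ 2 + 2 / s ^+ 2 * (U - m) ^+ 2.
Proof.
move=> U0 UV s0; have V0 := le_trans U0 UV.
have sn0 : s != 0 by rewrite gt_eqF.
have [r [r0 r1 UE rE]] : exists r, [/\ 0 <= r, r <= 1, U = r * V & U / V = r].
  exists (U / V); rewrite divr_ge0//.
  have [VE|Vn0] := eqVneq V 0.
    by rewrite VE invr0 !mulr0; split=> //; apply/le_anti; rewrite U0 -VE UV.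
  by rewrite mulfVK// ler_pdivrMr ?mul1r// lt_neqAle eq_sym Vn0.
have -> : U / V - m / s = r * (s - V) / s + (U - m) / s.
  by rewrite rE UE; field.
apply: (le_trans (sqrrD_le2 _ _)).
apply: lerD; rewrite -[leRHS]mulrA ler_pM2l//.
  have -> : (s ^+ 4)^-1 * (V ^+ 2 - s ^+ 2) ^+ 2 =
      (V ^+ 2 - s ^+ 2) ^+ 2 / s ^+ 2 / s ^+ 2 by field.
  rewrite expr_div_n ler_wpM2r ?invr_ge0 ?sqr_ge0//.
  apply: le_trans (sqr_sub_le_sqr_sub V0 s0).
  rewrite exprMn -[(s - V) ^+ 2]sqrrN opprB.
  by rewrite ler_piMl ?sqr_ge0// exprn_ile1.
by rewrite expr_div_n mulrC.
Qed.

Lemma sqr_inv_ratio_sub_le U V m s t : 0 <= V -> 0 < m -> 0 < s -> 0 < t ->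
  t <= U ->
  (V / U - s / m) ^+ 2 <=
  2 / (s * t) ^+ 2 * (V ^+ 2 - s ^+ 2) ^+ 2 +
  2 * (s / (t * m)) ^+ 2 * (U - m) ^+ 2.
Proof.
move=> V0 m0 s0 t0 tU; have U0 := lt_le_trans t0 tU.
have [sn mn Un tn] : [/\ s != 0, m != 0, U != 0 & t != 0] by rewrite !gt_eqF.
have UVt : (U^-1) ^+ 2 <= (t^-1) ^+ 2.
  by rewrite lerXn2r ?nnegrE ?invr_ge0 ?lef_pV2 ?posrE ?(ltW U0) ?(ltW t0).
have -> : V / U - s / m = (V - s) / U + s / m * (m - U) / U.
  by field; rewrite mn Un.
apply: (le_trans (sqrrD_le2 _ _)).
apply: lerD; rewrite -[leRHS]mulrA ler_pM2l//.
  have -> : ((s * t) ^+ 2)^-1 * (V ^+ 2 - s ^+ 2) ^+ 2 =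
    (V ^+ 2 - s ^+ 2) ^+ 2 / s ^+ 2 * t^-1 ^+ 2 by field; rewrite sn tn.
  by rewrite exprMn ler_pM ?sqr_ge0 ?sqr_sub_le_sqr_sub.
have -> : (s / (t * m)) ^+ 2 * (U - m) ^+ 2 =
  (s / m * (m - U)) ^+ 2 * t^-1 ^+ 2 by field; rewrite mn tn.
by rewrite exprMn ler_wpM2l ?sqr_ge0.
Qed.

Lemma sqr_sub_le_max (r a k : R) : 0 <= r -> 0 <= a ->
  r ^+ 2 <= k -> a ^+ 2 <= k -> (r - a) ^+ 2 <= k.
Proof.
move=> r0 a0 rk ak; have [ra|ar] := leP r a.
  rewrite (le_trans _ ak)// -sqrrN opprB lerXn2r ?nnegrE ?subr_ge0//.
  by rewrite gerBl.
by rewrite (le_trans _ rk)// lerXn2r ?nnegrE ?subr_ge0 ?gerBl// ltW.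
Qed.

(* Below the cutoff [t] only the crude bound [(V / U) ^+ 2 <= N] is left. *)
Lemma sqr_inv_ratio_sub_le_cutoff U V m s t N : 0 <= U -> 0 <= V ->
  0 < m -> m <= s -> 0 < t -> (V / U) ^+ 2 <= N -> 1 <= N ->
  (V / U - s / m) ^+ 2 <=
  2 / (s * t) ^+ 2 * (V ^+ 2 - s ^+ 2) ^+ 2 +
  2 * (s / (t * m)) ^+ 2 * (U - m) ^+ 2 + N * (s / m) ^+ 2 * (U < t)%R%:R.
Proof.
move=> U0 V0 m0 ms t0 VUN N1; have s0 := lt_le_trans m0 ms.
have [Ut|tU] := ltP U t; last by rewrite mulr0 addr0 sqr_inv_ratio_sub_le.
have sm_ge1 : 1 <= (s / m) ^+ 2 by rewrite exprn_ege1// ler_pdivlMr// mul1r.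
rewrite mulr1 -[leLHS]add0r lerD//.
  by rewrite addr_ge0// mulr_ge0 ?sqr_ge0// mulr_ge0 ?invr_ge0 ?sqr_ge0.
have VU_ge0 : 0 <= V / U by rewrite divr_ge0.
have sm_ge0 : 0 <= s / m by rewrite divr_ge0 ?ltW.
apply: sqr_sub_le_max => //; last by rewrite ler_peMl ?sqr_ge0.
by rewrite (le_trans VUN)// ler_peMr// (le_trans _ N1).
Qed.

End ratio_bounds.

Lemma natr_mul_expr_quarter_le (R : realFieldType) (n : nat) :
  n%:R * 4^-1 ^+ n <= n%:R^-1 :> R.
Proof.
case: n => [|n]; first by rewrite mul0r invr0.
rewrite exprVn ler_pdivrMr ?exprn_gt0// ler_pdivlMl ?ltr0n// -natrX -natrM.
rewrite ler_nat -[4%N]/(2 ^ 2)%N -expnM mulnC expnM mulnn leq_sqr ltnW//.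
exact: ltn_expl.
Qed.

Section prod_measure.
Context (R : realType) d1 (T1 : measurableType d1) d2 (T2 : measurableType d2).
Context (Q1 : probability T1 R) (Q2 : probability T2 R).
Variables (f : T1 -> R) (g : T2 -> R).
Hypotheses (f1 : f \in Lfun Q1 1) (g1 : g \in Lfun Q2 1).

Let integrable_f : Q1.-integrable setT (EFin \o f).
Proof. exact/Lfun1_integrable. Qed.

Let integrable_g : Q2.-integrable setT (EFin \o g).
Proof. exact/Lfun1_integrable. Qed.

Lemma integrable_prod_measureM :
  (Q1 \x Q2)%E.-integrable setT (fun z => (f z.1 * g z.2)%:E).
Proof.
have [mf mg] := (Lfun_measurable f1, Lfun_measurable g1).
have [/integrableP[_ f_fin] /integrableP[_ g_fin]] :=
  (integrable_f, integrable_g).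
apply/integrable12ltyP => /=.
  apply/measurable_EFinP/measurable_funM; exact: measurableT_comp.
under eq_integral => x _.
  under eq_integral do rewrite normrM EFinM.
  rewrite ge0_integralZl//; last exact/measurable_EFinP/measurableT_comp.
  over.
rewrite /= ge0_integralZr//.
- by rewrite lte_mul_pinfty ?integral_ge0// ge0_fin_numE// integral_ge0.
- exact/measurable_EFinP/measurableT_comp.
- by apply: integral_ge0 => y _; rewrite lee_fin.
Qed.

Lemma integral_prod_measureM :
  (\int[Q1 \x Q2]_z (f z.1 * g z.2)%:E = 'E_Q1[f] * 'E_Q2[g])%E.
Proof.
rewrite -integral12_prod_meas1 /fubini_F; last exact: integrable_prod_measureM.
under eq_integral => x _.
  under eq_integral do rewrite /= EFinM.
  rewrite integralZl//; over.
have := expectation_fin_num g1; rewrite unlock => g_fin.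
by rewrite /= -(fineK g_fin) integralZr.
Qed.

End prod_measure.

Definition iid_law (R : realType) d (T : measurableType d) d'
    (E : measurableType d') (P : probability T R) (Q : probability E R)
    (n : nat) (X : 'I_n -> T -> E) : Prop :=
  forall B : 'I_n -> set E, (forall i, measurable (B i)) ->
    P (\bigcap_(i in [set: 'I_n]) (X i @^-1` B i)) =
    (\prod_(i < n) Q (B i))%E.

Lemma iid_law_comp (R : realType) d (T : measurableType d) d1 d2
    (E1 : measurableType d1) (E2 : measurableType d2) (P : probability T R)
    (Q1 : probability E1 R) (Q2 : probability E2 R) (g : E1 -> E2)
    (n : nat) (X : 'I_n -> T -> E1) :
  measurable_fun setT g ->
  (forall B, measurable B -> Q2 B = Q1 (g @^-1` B)) ->
  iid_law P Q1 X -> iid_law P Q2 (fun i => g \o X i).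
Proof.
move=> mg Q2E iidX B mB.
under eq_bigr do rewrite Q2E//.
rewrite -iidX// => i; rewrite -[_ @^-1` _]setTI; exact: mg.
Qed.

Section iid.
Context (R : realType) d (T : measurableType d) d' (E : measurableType d').
Context (P : probability T R) (Q : probability E R).
Context (n : nat) (X : 'I_n -> T -> E).
Hypotheses (mX : forall i, measurable_fun setT (X i)) (iidX : iid_law P Q X).
Implicit Types (f g : E -> R) (A B : set E).

Lemma iid_bigcap (S : {set 'I_n}) (B : 'I_n -> set E) :
  (forall i, measurable (B i)) ->
  P (\bigcap_(i in [set i | i \in S]) (X i @^-1` B i)) =
  (\prod_(i in S) Q (B i))%E.
Proof.
move=> mB; pose B' i := if i \in S then B i else setT.
have -> : \bigcap_(i in [set i | i \in S]) (X i @^-1` B i) =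
          \bigcap_(i in [set: 'I_n]) (X i @^-1` B' i).
  apply/seteqP; split=> w /= h i /= iS.
    by rewrite /B'; case: ifPn => // iS'; exact: h.
  by have := h i I; rewrite /B' iS.
rewrite iidX; last by move=> i; rewrite /B'; case: ifP.
rewrite [RHS]big_mkcond; apply: eq_bigr => i _; rewrite /B'.
by case: ifP => // _; rewrite probability_setT.
Qed.

Lemma iid_marginal i A : measurable A -> pushforward P (X i) A = Q A.
Proof.
move=> mA; have := @iid_bigcap [set i]%SET (fun=> A) (fun=> mA).
rewrite big_set1 => <-; congr (P _).
apply/seteqP; split=> w /= h.
  by move=> j /=; rewrite inE => /eqP ->.
by apply: (h i); rewrite /= inE.
Qed.

Lemma iid_joint_law i j (A : set (E * E)) : i != j -> measurable A ->
  pushforward P (fun w => (X i w, X j w)) A = (Q \x Q)%E A.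
Proof.
move=> ij mA; apply/esym.
have mXij : measurable_fun setT (fun w => (X i w, X j w)).
  exact: measurable_fun_pair.
apply: (@product_measure_unique _ _ _ _ _ Q Q
  (pushforward P (fun w => (X i w, X j w)))) => // B C mB mC.
have := @iid_bigcap [set i; j]%SET (fun k => if k == i then B else C).
rewrite big_setU1 ?inE//= big_set1 eqxx eq_sym (negbTE ij) => <-; last first.
  by move=> k; case: ifP.
congr (P _); apply/seteqP; split=> w /= h.
  move=> k /=; rewrite !inE; case: (eqVneq k i) => [-> _|_ /= /eqP ->].
    by case: h.
  by case: h.
split.
  by have := h i; rewrite /= !inE eqxx => /(_ isT).
by have := h j; rewrite /= !inE eqxx orbT eq_sym (negbTE ij) => /(_ isT).
Qed.

Lemma iid_ge0_integral i (f : E -> \bar R) : measurable_fun setT f ->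
  (forall x, 0 <= f x)%E -> (\int[P]_w f (X i w) = \int[Q]_x f x)%E.
Proof.
move=> mf f0; transitivity (\int[pushforward P (X i)]_x f x)%E.
  by rewrite ge0_integral_pushforward.
by apply: eq_measure_integral => A mA _; exact: iid_marginal.
Qed.

Lemma iid_Lfun i r f : f \in Lfun Q r%:E -> f \o X i \in Lfun P r%:E.
Proof.
move=> /[dup] fr; rewrite !inE => /andP[/[1!inE] mf /[1!inE] finf].
apply/andP; split; rewrite inE; first exact: measurableT_comp.
move: finf; rewrite /= /finite_norm !unlock.
rewrite (@iid_ge0_integral i (fun x => (`|(EFin \o f) x| `^ r)%E))//.
- apply/measurable_EFinP.
  apply: (measurableT_comp (measurable_powR r)).
  exact: (measurableT_comp _ mf).
- by move=> x; exact: poweR_ge0.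
Qed.

Lemma iid_expectation i f : f \in Lfun Q 1 -> ('E_P[f \o X i] = 'E_Q[f])%E.
Proof.
move=> f1; have mf := Lfun_measurable f1.
have fX1 := iid_Lfun i f1; rewrite unlock.
transitivity (\int[pushforward P (X i)]_x (f x)%:E)%E.
  rewrite integral_pushforward//; first exact/measurable_EFinP.
  exact/Lfun1_integrable.
by apply: eq_measure_integral => A mA _; exact: iid_marginal.
Qed.

Lemma iid_expectationM i j f g : i != j ->
  f \in Lfun Q 2%:E -> g \in Lfun Q 2%:E ->
  ('E_P[((f \o X i) * (g \o X j))%R] = 'E_Q[f] * 'E_Q[g])%E.
Proof.
move=> ij f2 g2; have [f1 g1] := (Lfun2_Lfun1 f2, Lfun2_Lfun1 g2).
have [mf mg] := (Lfun_measurable f1, Lfun_measurable g1).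
pose Z w := (X i w, X j w); pose h (z : E * E) := (f z.1 * g z.2)%:E.
have mZ : measurable_fun setT Z by exact: measurable_fun_pair.
have mh : measurable_fun setT h.
  apply/measurable_EFinP/measurable_funM; exact: measurableT_comp.
have ih : P.-integrable setT (h \o Z).
  by apply/Lfun1_integrable; apply: Lfun2_mul_Lfun1; exact: iid_Lfun.
rewrite -(integral_prod_measureM f1 g1) unlock.
transitivity (\int[pushforward P Z]_z h z)%E.
  by rewrite integral_pushforward.
by apply: eq_measure_integral => A mA _; exact: iid_joint_law.
Qed.

Lemma iid_covariance i j f g : i != j ->
  f \in Lfun Q 2%:E -> g \in Lfun Q 2%:E ->
  covariance P (f \o X i) (g \o X j) = 0%E.
Proof.
move=> ij f2 g2; have [f1 g1] := (Lfun2_Lfun1 f2, Lfun2_Lfun1 g2).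
have [fX2 gX2] := (iid_Lfun i f2, iid_Lfun j g2).
rewrite covarianceE ?Lfun2_mul_Lfun1 ?Lfun2_Lfun1//.
rewrite iid_expectationM// !iid_expectation// subee//.
by rewrite fin_numM ?expectation_fin_num.
Qed.

Lemma iid_variance i f : f \in Lfun Q 2%:E -> 'V_P[f \o X i] = 'V_Q[f].
Proof.
move=> f2; rewrite !varianceE ?iid_Lfun//.
rewrite -(iid_expectation i (Lfun2_sqr_Lfun1 f2)).
by rewrite iid_expectation// Lfun2_Lfun1.
Qed.

Local Notation mean f := (fun w => sample_mean (fun i => f (X i w))).

Lemma sample_mean_compE f : mean f = n%:R^-1 \o* \sum_(i < n) (f \o X i).
Proof. by apply/funext => w; rewrite /sample_mean /= fct_sumE. Qed.

Lemma measurable_sample_mean f :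
  measurable_fun setT f -> measurable_fun setT (mean f).
Proof.
move=> mf; apply: measurable_funM => //; apply: measurable_sum => i.
exact: measurableT_comp.
Qed.

Lemma iid_sample_mean_Lfun f r : 1 <= r -> f \in Lfun Q r%:E ->
  mean f \in Lfun P r%:E.
Proof.
move=> r1 fr; rewrite sample_mean_compE Lfun_scale// rpred_sum ?lee_fin// => *.
exact: iid_Lfun.
Qed.

Hypothesis n_gt0 : (0 < n)%N.

Lemma iid_expectation_sample_mean f : f \in Lfun Q 1 ->
  ('E_P[mean f] = 'E_Q[f])%E.
Proof.
move=> f1; have fX1 i := iid_Lfun i f1.
rewrite sample_mean_compE expectationZl ?rpred_sum ?lexx//.
rewrite -(big_map _ xpredT id) expectation_sum => [|_ /mapP[i _ ->]//].
rewrite big_map.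
under eq_bigr do rewrite iid_expectation//.
rewrite -(fineK (expectation_fin_num f1)) sumEFin sumr_const card_ord -EFinM.
by congr (_%:E); rewrite -[_ *+ n]mulr_natr; field; rewrite pnatr_eq0 -lt0n.
Qed.

Lemma iid_mse_sample_mean f : f \in Lfun Q 2%:E ->
  mse P (mean f) (fine 'E_Q[f]) = ((n%:R^-1)%:E * 'V_Q[f])%E.
Proof.
move=> f2; have fX2 i := iid_Lfun i f2.
rewrite -iid_expectation_sample_mean ?Lfun2_Lfun1// mse_expectation.
rewrite sample_mean_compE varianceZ ?rpred_sum ?lee1n//.
rewrite variance_sum ?index_enum_uniq// => [|i j _ _ ij]; last first.
  exact: iid_covariance.
under eq_bigr do rewrite iid_variance//.
rewrite -(fineK (variance_fin_num f2)) sumEFin sumr_const card_ord -!EFinM.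
by congr (_%:E); rewrite -[_ *+ n]mulr_natr; field; rewrite pnatr_eq0 -lt0n.
Qed.

Lemma iid_prob_bigcap_le (S : {set 'I_n}) B (p : R) : measurable B ->
  0 <= p <= 1 -> (Q B <= (p ^+ 2)%:E)%E -> (n <= 2 * #|S|)%N ->
  (P (\bigcap_(i in [set i | i \in S]) (X i @^-1` B)) <= (p ^+ n)%:E)%E.
Proof.
move=> mB /andP[p0 p1] Qp nS; rewrite (iid_bigcap S (fun=> mB)).
have fQ : Q B \is a fin_num by exact: fin_num_measure.
move: Qp; rewrite -(fineK fQ) prodEFin !lee_fin prodr_const => Qp.
apply: (@le_trans _ _ ((p ^+ 2) ^+ #|S|)).
  by rewrite lerXn2r// nnegrE ?exprn_ge0// fine_ge0.
by rewrite -exprM ler_wiXn2l.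
Qed.

(* Union bound over the sets of at least n/2 indices i with g (X i) <= 2t. *)
Lemma iid_sample_mean_lt_le g (t p : R) : measurable_fun setT g ->
  (forall x, 0 <= g x) -> 0 <= p <= 1 ->
  (Q [set x | (g x <= 2 * t)%R] <= (p ^+ 2)%:E)%E ->
  (P [set w | (sample_mean (fun i => g (X i w)) < t)%R] <=
   ((2 * p) ^+ n)%:E)%E.
Proof.
move=> mg g0 p01 Qp; set A := [set w | _]; pose B := [set x | g x <= 2 * t].
have mB : measurable B.
  have := mg measurableT _ (measurable_itv `]-oo, 2 * t]).
  by rewrite setTI set_itvNyc.
pose F (S : {set 'I_n}) := \bigcap_(i in [set i | i \in S]) (X i @^-1` B).
have mF S : measurable (F S).
  apply: fin_bigcap_measurable; first exact: finite_finset.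
  by move=> i _; rewrite -[_ @^-1` _]setTI; exact: mX.
pose r := enum [pred S : {set 'I_n} | (n <= 2 * #|S|)%N].
have A_sub : A `<=` \bigcup_(S in [set` r]) F S.
  move=> w; rewrite /A /= => /(sample_mean_lt_card (fun i => g0 _)) nS.
  exists [set i | g (X i w) <= 2 * t]%SET; first by rewrite /= mem_enum inE.
  by move=> i; rewrite /= inE.
have mA : measurable A.
  have := measurable_sample_mean mg measurableT (measurable_itv `]-oo, t[).
  by rewrite setTI set_itvNyo.
apply: (@le_trans _ _ (\sum_(S \in [set` r]) P (F S))%E).
  exact: content_sub_fsum.
rewrite -fsbig_seq ?enum_uniq// big_enum/=.
apply: (@le_trans _ _ (\sum_(S : {set 'I_n}) (p ^+ n)%:E)%E).
  rewrite big_mkcond; apply: lee_sum => S _; case: ifP => [nS|_].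
    exact: iid_prob_bigcap_le.
  by rewrite lee_fin exprn_ge0//; case/andP: p01.
rewrite sumEFin sumr_const -cardsT -powersetT card_powerset cardsT card_ord.
by rewrite lee_fin exprMn -[leLHS]mulr_natl natrX.
Qed.

End iid.

Definition mean_abs (R : realFieldType) (n : nat) (x : 'I_n -> R) : R :=
  sample_mean (fun i => `|x i|).

Definition root_mean_sqr (R : rcfType) (n : nat) (x : 'I_n -> R) : R :=
  Num.sqrt (sample_mean (fun i => x i ^+ 2)).

Section means.
Context (R : rcfType) (n : nat).
Implicit Type x : 'I_n -> R.

Lemma mean_abs_ge0 x : 0 <= mean_abs x.
Proof. by rewrite divr_ge0// sumr_ge0. Qed.

Lemma root_mean_sqr_ge0 x : 0 <= root_mean_sqr x.
Proof. exact: sqrtr_ge0. Qed.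

Lemma sqr_root_mean_sqr x :
  root_mean_sqr x ^+ 2 = sample_mean (fun i => x i ^+ 2).
Proof.
by rewrite sqr_sqrtr// divr_ge0// sumr_ge0// => i _; rewrite sqr_ge0.
Qed.

Lemma sample_mean_sqr_normr x :
  sample_mean (fun i => `|x i| ^+ 2) = sample_mean (fun i => x i ^+ 2).
Proof.
by congr (_ / _); apply: eq_bigr => i _; rewrite real_normK ?num_real.
Qed.

Lemma mean_abs_le_root_mean_sqr x : mean_abs x <= root_mean_sqr x.
Proof.
rewrite -(@ler_pXn2r _ 2) ?nnegrE ?mean_abs_ge0 ?root_mean_sqr_ge0//.
rewrite sqr_root_mean_sqr -sample_mean_sqr_normr.
exact: sqr_sample_mean_le.
Qed.

Lemma sqr_root_mean_sqr_div_mean_abs_le x :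
  (root_mean_sqr x / mean_abs x) ^+ 2 <= n%:R.
Proof.
have [->|U0] := eqVneq (mean_abs x) 0; first by rewrite invr0 mulr0 expr0n.
rewrite expr_div_n ler_pdivrMr ?exprn_even_gt0// sqr_root_mean_sqr.
by rewrite -sample_mean_sqr_normr; exact: sample_mean_sqr_le.
Qed.

End means.

Section ell.
Context (R : realType) d (T : measurableType d) (n : nat).
Implicit Types (X : 'I_n -> T -> R) (k : R).

Lemma ell1_ge0 X w : 0 <= ell1 X w.
Proof. exact: sumr_ge0. Qed.

Lemma ell2_ge0 X w : 0 <= ell2 X w.
Proof. exact: sqrtr_ge0. Qed.

Lemma ell1Z X k : ell1 (fun i w => k * X i w) = (fun w => `|k| * ell1 X w).
Proof.
apply/funext => w; rewrite /ell1 mulr_sumr.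
by apply: eq_bigr => i _; rewrite normrM.
Qed.

Lemma ell2Z X k : ell2 (fun i w => k * X i w) = (fun w => `|k| * ell2 X w).
Proof.
apply/funext => w; rewrite /ell2 -sqrtr_sqr -sqrtrM ?sqr_ge0// mulr_sumr.
by congr Num.sqrt; apply: eq_bigr => i _; rewrite exprMn.
Qed.

Lemma measurable_ell1 X : (forall i, measurable_fun setT (X i)) ->
  measurable_fun setT (ell1 X).
Proof. by move=> mX; apply: measurable_sum => i; exact: measurableT_comp. Qed.

Lemma measurable_ell2 X : (forall i, measurable_fun setT (X i)) ->
  measurable_fun setT (ell2 X).
Proof.
move=> mX.
have msqrt : measurable_fun [set: R] (Num.sqrt : R -> R).
  by apply: continuous_measurable_fun; exact: sqrt_continuous.
apply: (measurableT_comp msqrt); apply: measurable_sum => i.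
exact: measurable_funX.
Qed.

Lemma normalized_ell1Z (P : probability T R) X k : k != 0 ->
  (forall i, measurable_fun setT (X i)) ->
  normalized P (ell1 (fun i w => k * X i w)) = normalized P (ell1 X).
Proof.
move=> k0 mX; rewrite ell1Z normalizedZ ?normr_gt0//; last exact: ell1_ge0.
exact: measurable_ell1.
Qed.

Lemma normalized_ell2Z (P : probability T R) X k : k != 0 ->
  (forall i, measurable_fun setT (X i)) ->
  normalized P (ell2 (fun i w => k * X i w)) = normalized P (ell2 X).
Proof.
move=> k0 mX; rewrite ell2Z normalizedZ ?normr_gt0//; last exact: ell2_ge0.
exact: measurable_ell2.
Qed.

Lemma mean_absE X w : mean_abs (X^~ w) = n%:R^-1 * ell1 X w.
Proof. by rewrite mulrC. Qed.

Lemma root_mean_sqrE X w : root_mean_sqr (X^~ w) = Num.sqrt n%:R^-1 * ell2 X w.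
Proof. by rewrite -sqrtrM ?invr_ge0// mulrC. Qed.

End ell.

Section law.
Context (R : realType) (Q : probability R R).

Definition absolute_mean : R := fine 'E_Q[Num.norm].

Definition quadratic_mean : R := Num.sqrt (fine 'E_Q[(fun x => x ^+ 2)%R]).

Local Notation m := absolute_mean.
Local Notation s := quadratic_mean.
Local Notation var_abs := (fine 'V_Q[Num.norm]).
Local Notation var_sqr := (fine 'V_Q[(fun x => x ^+ 2)%R]).

Definition ratio_variance_bound : R :=
  (s / m) ^+ 2 * (2 / s ^+ 4 * var_sqr + 2 / s ^+ 2 * var_abs).

Definition inv_ratio_variance_bound (t : R) : R :=
  2 / (s * t) ^+ 2 * var_sqr + 2 * (s / (t * m)) ^+ 2 * var_abs + (s / m) ^+ 2.

Let var_abs_ge0 : 0 <= var_abs.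
Proof. exact/fine_ge0/variance_ge0. Qed.

Let var_sqr_ge0 : 0 <= var_sqr.
Proof. exact/fine_ge0/variance_ge0. Qed.

Lemma ratio_variance_bound_ge0 : 0 <= ratio_variance_bound.
Proof.
rewrite mulr_ge0 ?sqr_ge0// addr_ge0// mulr_ge0// divr_ge0// ?sqr_ge0//.
by rewrite exprn_even_ge0.
Qed.

Lemma inv_ratio_variance_bound_ge0 t : 0 <= inv_ratio_variance_bound t.
Proof.
rewrite addr_ge0 ?sqr_ge0// addr_ge0// mulr_ge0//.
  by rewrite mulr_ge0 ?invr_ge0 ?sqr_ge0.
by rewrite mulr_ge0 ?sqr_ge0.
Qed.

Hypothesis sqr_Lfun2 : (fun x => x ^+ 2) \in Lfun Q 2%:E.

Lemma normr_Lfun2 : (Num.norm : R -> R) \in Lfun Q 2%:E.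
Proof.
apply: expectation_sqr_lty_Lfun2; first exact: normr_measurable.
rewrite (_ : (fun x : R => `|x| ^+ 2) = (fun x => x ^+ 2)); last first.
  by apply/funext => x; rewrite real_normK ?num_real.
have := expectation_fin_num (Lfun2_Lfun1 sqr_Lfun2).
by rewrite ge0_fin_numE// expectation_ge0// => x; exact: sqr_ge0.
Qed.

Lemma sqr_quadratic_mean : s ^+ 2 = fine 'E_Q[(fun x => x ^+ 2)%R].
Proof.
by rewrite sqr_sqrtr//; apply/fine_ge0/expectation_ge0 => x; exact: sqr_ge0.
Qed.

Hypothesis no_atom0 : Q [set 0] = 0%E.

Lemma absolute_mean_gt0 : 0 < m.
Proof.
have m_ge0 : 0 <= m by exact/fine_ge0/expectation_ge0.
rewrite lt_neqAle m_ge0 andbT eq_sym; apply/eqP => m0.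
have mnorm : measurable_fun [set: R] (fun x : R => `|x|%:E).
  by apply/measurable_EFinP; exact: normr_measurable.
have [N [mN QN0 N_sub]] : ae_eq Q setT (fun x : R => `|x|%:E) (cst 0%E).
  apply/(ae_eq_integral_abs _ _ mnorm) => //.
  transitivity ('E_Q[Num.norm])%E.
    by rewrite unlock; apply: eq_integral => x _; rewrite /= normr_id.
  have norm1 := Lfun2_Lfun1 normr_Lfun2.
  by rewrite -(fineK (expectation_fin_num norm1)) -/m m0.
suff : (Q setT <= 0)%E by rewrite probability_setT lee_fin ler10.
have setT_sub : setT `<=` [set 0] `|` N.
  move=> x _; have [->|x0] := eqVneq x 0; [by left|right; apply: N_sub => /=].
  by move=> /(_ I) [/normr0_eq0]; exact/eqP.
apply: le_trans (le_measure _ _ _ setT_sub) _; rewrite ?inE//.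
  exact: measurableU.
have := measureU2 Q (measurable_set1 0) mN.
by rewrite [X in (_ <= X + _)%E]no_atom0 [X in (_ <= _ + X)%E]QN0 adde0.
Qed.

Lemma normr_small_ball (p : R) : 0 < p ->
  exists2 t, 0 < t & (Q [set x | (`|x| <= 2 * t)%R] < p%:E)%E.
Proof.
move=> p0; have [||t t0 Qt] := @probability_le_right_lt _ _ _ Q Num.norm 0 p.
- exact: normr_measurable.
- have -> : [set x : R | `|x| <= 0] = [set 0].
    by apply/seteqP; split=> x /=; rewrite normr_le0 => /eqP.
  by rewrite no_atom0 lte_fin.
- exists (t / 2); first by rewrite divr_gt0.
  by rewrite mulrC divfK.
Qed.

End law.

Section iid_ratio.
Context (R : realType) d (T : measurableType d) (P : probability T R).
Context (Q : probability R R) (n : nat) (X : 'I_n -> T -> R).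
Hypotheses (mX : forall i, measurable_fun setT (X i)) (iidX : iid_law P Q X).
Hypotheses (n_gt0 : (0 < n)%N) (sqr_Lfun2 : (fun x => x ^+ 2) \in Lfun Q 2%:E).
Hypothesis no_atom0 : Q [set 0] = 0%E.

Let U w := mean_abs (X^~ w).
Let V w := root_mean_sqr (X^~ w).
Let m := absolute_mean Q.
Let s := quadratic_mean Q.
Let var_abs := fine 'V_Q[Num.norm].
Let var_sqr := fine 'V_Q[(fun x => x ^+ 2)].
Let mean_V := fine 'E_P[V].

Let norm_Lfun2 := normr_Lfun2 sqr_Lfun2.
Let m_gt0 : 0 < m. Proof. exact: absolute_mean_gt0. Qed.

Let U_ge0 w : 0 <= U w. Proof. exact: mean_abs_ge0. Qed.
Let V_ge0 w : 0 <= V w. Proof. exact: root_mean_sqr_ge0. Qed.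
Let le_UV w : U w <= V w. Proof. exact: mean_abs_le_root_mean_sqr. Qed.

Let sqr_VE : (fun w => V w ^+ 2) = (fun w => sample_mean (fun i => X i w ^+ 2)).
Proof. by apply/funext => w; rewrite /V sqr_root_mean_sqr. Qed.

Let expectation_U : ('E_P[U] = m%:E)%E.
Proof.
have norm1 := Lfun2_Lfun1 norm_Lfun2.
rewrite (iid_expectation_sample_mean mX iidX n_gt0 norm1).
by rewrite fineK ?expectation_fin_num.
Qed.

Let expectation_sqr_V : ('E_P[(fun w => V w ^+ 2)%R] = (s ^+ 2)%:E)%E.
Proof.
have sqr1 := Lfun2_Lfun1 sqr_Lfun2.
rewrite sqr_VE (iid_expectation_sample_mean mX iidX n_gt0 sqr1).
by rewrite sqr_quadratic_mean fineK ?expectation_fin_num.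
Qed.

Let measurable_V : measurable_fun setT V.
Proof.
have -> : V = (fun w => Num.sqrt n%:R^-1 * ell2 X w).
  by apply/funext => w; exact: root_mean_sqrE.
by apply: measurable_funM => //; exact: measurable_ell2.
Qed.

Let U_Lfun2 : U \in Lfun P 2%:E.
Proof.
by apply: (iid_sample_mean_Lfun mX iidX _ norm_Lfun2); rewrite ler1n.
Qed.

Let measurable_U : measurable_fun setT U.
Proof. exact: Lfun_measurable U_Lfun2. Qed.

Let V_Lfun2 : V \in Lfun P 2%:E.
Proof.
by apply: expectation_sqr_lty_Lfun2; rewrite ?expectation_sqr_V ?ltry.
Qed.

Let sqr_V_Lfun2 : (fun w => V w ^+ 2) \in Lfun P 2%:E.
Proof.
rewrite sqr_VE.
by apply: (iid_sample_mean_Lfun mX iidX _ sqr_Lfun2); rewrite ler1n.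
Qed.

Let mse_U : mse P U m = (var_abs / n%:R)%:E.
Proof.
rewrite (iid_mse_sample_mean mX iidX n_gt0 norm_Lfun2) mulrC EFinM.
by rewrite fineK// variance_fin_num.
Qed.

Let mse_sqr_V : mse P (fun w => V w ^+ 2) (s ^+ 2) = (var_sqr / n%:R)%:E.
Proof.
rewrite sqr_VE /s sqr_quadratic_mean.
rewrite (iid_mse_sample_mean mX iidX n_gt0 sqr_Lfun2) mulrC EFinM.
by rewrite fineK// variance_fin_num.
Qed.

Let expectation_V : ('E_P[V] = mean_V%:E)%E.
Proof. by rewrite fineK// expectation_fin_num// Lfun2_Lfun1. Qed.

Let m_le_mean_V : m <= mean_V.
Proof.
rewrite -lee_fin -expectation_U -expectation_V.
by apply: expectation_le => //; exact: aeW.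
Qed.

Let mean_V_le_s : mean_V <= s.
Proof.
rewrite -(@ler_pXn2r _ 2) ?nnegrE ?sqrtr_ge0 ?(le_trans (ltW m_gt0))//.
have := sqr_expectation_le V_Lfun2.
by rewrite expectation_sqr_V expectation_V -EFin_expe lee_fin.
Qed.

Let mean_V_gt0 : 0 < mean_V. Proof. exact: lt_le_trans m_le_mean_V. Qed.
Let s_gt0 : 0 < s. Proof. exact: lt_le_trans mean_V_le_s. Qed.

Let normalized_ell1E : normalized P (ell1 X) = (fun w => U w / m).
Proof.
rewrite -(@normalizedZ _ _ _ _ _ n%:R^-1) ?invr_gt0 ?ltr0n//; last 2 first.
- exact: measurable_ell1.
- exact: ell1_ge0.
have <- : U = (fun w => n%:R^-1 * ell1 X w).
  by apply/funext => w; exact: mean_absE.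
by rewrite /normalized expectation_U.
Qed.

Let normalized_ell2E : normalized P (ell2 X) = (fun w => V w / mean_V).
Proof.
rewrite -(@normalizedZ _ _ _ _ _ (Num.sqrt n%:R^-1)).
- by congr (normalized P _); apply/funext => w; rewrite -root_mean_sqrE.
- by rewrite sqrtr_gt0 invr_gt0 ltr0n.
- exact: measurable_ell2.
- exact: ell2_ge0.
Qed.

Let measurable_ratio : measurable_fun setT (fun w => U w / V w).
Proof. by apply: measurable_funM => //; exact: measurable_funV. Qed.

Let measurable_inv_ratio : measurable_fun setT (fun w => V w / U w).
Proof. by apply: measurable_funM => //; exact: measurable_funV. Qed.

Let mse_ratio_le :
  (mse P (fun w => U w / V w)%R (m / s) <=
   ((2 / s ^+ 4 * var_sqr + 2 / s ^+ 2 * var_abs) / n%:R)%:E)%E.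
Proof.
apply: (@le_trans _ _ ((2 / s ^+ 4)%:E * mse P (fun w => V w ^+ 2)%R (s ^+ 2) +
    (2 / s ^+ 2)%:E * mse P U m)%E); last first.
  by rewrite mse_sqr_V mse_U -!EFinM -EFinD lee_fin [leRHS]mulrDl !mulrA.
apply: le_expectation_lincomb => [||||w]; rewrite ?Lfun2_sqr_sub_Lfun1//.
- exact/measurable_funX/measurable_funB.
- by move=> w; exact: sqr_ge0.
- exact: sqr_ratio_sub_le.
Qed.

Lemma iid_variance_ell1_div_ell2_le :
  ('V_P[(fun w => normalized P (ell1 X) w / normalized P (ell2 X) w)%R] <=
   (ratio_variance_bound Q / n%:R)%:E)%E.
Proof.
have -> : (fun w => normalized P (ell1 X) w / normalized P (ell2 X) w) =
    (fun w => mean_V / m * (U w / V w)).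
  apply/funext => w; rewrite normalized_ell1E normalized_ell2E invf_div.
  by rewrite mulrACA [RHS]mulrACA [mean_V * _]mulrC [m^-1 * _]mulrC.
apply: le_trans (variance_le_mse P (mean_V / m * (m / s)) _) _.
  exact: measurable_funM.
rewrite mseZ// -mulrA [leRHS]EFinM lee_pmul ?mse_ratio_le ?lee_fin ?sqr_ge0//.
  by apply: expectation_ge0 => w; exact: sqr_ge0.
have [s0 e0] := (ltW s_gt0, ltW mean_V_gt0).
by rewrite lerXn2r ?nnegrE ?divr_ge0 ?(ltW m_gt0)// ler_pM2r ?invr_gt0.
Qed.

Variable t : R.
Hypothesis t_gt0 : 0 < t.
Hypothesis small_ball : (Q [set x | (`|x| <= 2 * t)%R] <= (8^-1 ^+ 2)%:E)%E.

Let measurable_U_lt : measurable [set w | U w < t].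
Proof.
have := measurable_U measurableT (measurable_itv `]-oo, t[).
by rewrite setTI set_itvNyo.
Qed.

Let prob_U_lt_le : (P [set w | (U w < t)%R] <= (4^-1 ^+ n)%:E)%E.
Proof.
have -> : 4^-1 = 2 * 8^-1 :> R by field.
apply: (iid_sample_mean_lt_le mX iidX _ _ _ small_ball) => //.
by rewrite invr_ge0 ler0n/= invf_le1 ?ler1n ?ltr0n.
Qed.

Let sqr_inv_ratio_sub_le_indic w : (V w / U w - s / m) ^+ 2 <=
  2 / (s * t) ^+ 2 * (V w ^+ 2 - s ^+ 2) ^+ 2 +
  1 * (2 * (s / (t * m)) ^+ 2 * (U w - m) ^+ 2 +
       n%:R * (s / m) ^+ 2 * \1_[set w | U w < t] w).
Proof.
rewrite mul1r addrA.
have -> : \1_[set w | U w < t] w = (U w < t)%R%:R :> R.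
  by rewrite indicE; congr (nat_of_bool _)%:R; apply/idP/idP; rewrite inE.
apply: sqr_inv_ratio_sub_le_cutoff => //.
- exact: le_trans mean_V_le_s.
- exact: sqr_root_mean_sqr_div_mean_abs_le.
- by rewrite ler1n.
Qed.

Let mse_inv_ratio_le :
  (mse P (fun w => V w / U w)%R (s / m) <=
   (inv_ratio_variance_bound Q t / n%:R)%:E)%E.
Proof.
have U_sub_Lfun1 := Lfun2_sqr_sub_Lfun1 m U_Lfun2.
have indic_Lfun1 : \1_[set w | U w < t] \in Lfun P 1.
  exact/Lfun1_integrable/integrable_indic.
apply: (@le_trans _ _ ((2 / (s * t) ^+ 2)%:E * (var_sqr / n%:R)%:E + 1%:E *
    ((2 * (s / (t * m)) ^+ 2)%:E * (var_abs / n%:R)%:E +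
     (n%:R * (s / m) ^+ 2)%:E * P [set w | (U w < t)%R]))%E).
  rewrite -mse_sqr_V -mse_U -expectation_indic// -expectation_lincomb//.
  apply: le_expectation_lincomb sqr_inv_ratio_sub_le_indic.
  - exact: Lfun2_sqr_sub_Lfun1.
  - exact: Lfun1_lincomb.
  - exact/measurable_funX/measurable_funB.
  - by move=> w; exact: sqr_ge0.
have cutoff_le : ((n%:R * (s / m) ^+ 2)%:E * P [set w | (U w < t)%R] <=
    ((s / m) ^+ 2 / n%:R)%:E)%E.
  apply: (le_trans (lee_wpmul2l _ prob_U_lt_le)).
    by rewrite lee_fin mulr_ge0 ?sqr_ge0.
  rewrite -EFinM lee_fin mulrAC [leRHS]mulrC ler_wpM2r ?sqr_ge0//.
  exact: natr_mul_expr_quarter_le.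
rewrite mul1e addeA; apply: (le_trans (leeD2l _ cutoff_le)).
rewrite /inv_ratio_variance_bound -/m -/s -/var_abs -/var_sqr.
move: (2 / (s * t) ^+ 2) (2 * (s / (t * m)) ^+ 2) => p q.
by rewrite -!EFinM -!EFinD lee_fin !mulrDl !mulrA.
Qed.

Lemma iid_variance_ell2_div_ell1_le :
  ('V_P[(fun w => normalized P (ell2 X) w / normalized P (ell1 X) w)%R] <=
   (inv_ratio_variance_bound Q t / n%:R)%:E)%E.
Proof.
have -> : (fun w => normalized P (ell2 X) w / normalized P (ell1 X) w) =
    (fun w => m / mean_V * (V w / U w)).
  apply/funext => w; rewrite normalized_ell1E normalized_ell2E invf_div.
  by rewrite mulrACA [RHS]mulrACA [m * _]mulrC [mean_V^-1 * _]mulrC.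
apply: le_trans (variance_le_mse P (m / mean_V * (s / m)) _) _.
  exact: measurable_funM.
rewrite mseZ// (le_trans _ mse_inv_ratio_le)//.
rewrite -[leRHS]mul1e lee_wpmul2r ?lee_fin//.
  by apply: expectation_ge0 => w; exact: sqr_ge0.
by rewrite exprn_ile1 ?divr_ge0 ?ler_pdivrMr ?mul1r// ltW.
Qed.

End iid_ratio.

Theorem iid_variance_normalized_ratio_le (R : realType) (Q : probability R R) :
  (fun x => x ^+ 2) \in Lfun Q 2%:E -> Q [set 0] = 0%E ->
  exists C : R, 0 < C /\
  forall n d (T : measurableType d) (P : probability T R) (X : 'I_n -> T -> R),
    (0 < n)%N -> (forall i, measurable_fun setT (X i)) -> iid_law P Q X ->
    (maxe 'V_P[(fun w => normalized P (ell2 X) w / normalized P (ell1 X) w)%R]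
          'V_P[(fun w => normalized P (ell1 X) w / normalized P (ell2 X) w)%R]
      <= (C / n%:R)%:E)%E.
Proof.
move=> sqr2 no_atom0.
have [|t t_gt0 /ltW Qt] := normr_small_ball no_atom0 (p := 8^-1 ^+ 2).
  by rewrite exprn_gt0 ?invr_gt0.
set B12 := ratio_variance_bound Q; set B21 := inv_ratio_variance_bound Q t.
have [B12_ge0 B21_ge0] : 0 <= B12 /\ 0 <= B21.
  by rewrite ratio_variance_bound_ge0 inv_ratio_variance_bound_ge0.
exists (1 + B12 + B21); split; first by rewrite !ltr_wpDr.
move=> n d T P X n_gt0 mX iidX; rewrite ge_max; apply/andP; split.
- apply: (le_trans (iid_variance_ell2_div_ell1_le mX iidX n_gt0 sqr2 no_atom0
    t_gt0 Qt)).
  by rewrite lee_fin ler_wpM2r ?invr_ge0// lerDr addr_ge0.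
- apply: (le_trans (iid_variance_ell1_div_ell2_le mX iidX n_gt0 sqr2 no_atom0)).
  by rewrite lee_fin ler_wpM2r ?invr_ge0// addrAC lerDr addr_ge0.
Qed.

Lemma lebesgue_measureZ (R : realType) (k : R) (A : set (measurableTypeR R)) :
  0 < k -> measurable A ->
  lebesgue_measure A =
  (k%:E * lebesgue_measure ((fun x => (k * x)%R) @^-1` A))%E.
Proof.
move=> k0 mA.
have mk : measurable_fun [set: measurableTypeR R] (fun x => k * x).
  by apply: (@measurable_funM _ (measurableTypeR R)).
apply: (@lebesgue_measure_unique R (mscale (NngNum (ltW k0))
  (pushforward lebesgue_measure (fun x : measurableTypeR R => k * x
    : measurableTypeR R)))) => // _ [[a b] _ <-].
rewrite -[RHS]/(k%:E * lebesgue_measure ((fun x => k * x)%R @^-1` `]a, b]))%E.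
have -> : (fun x => k * x) @^-1` `]a, b] = `](a / k), (b / k)]%classic.
  apply/seteqP; split=> x /=; rewrite !in_itv/=.
    by rewrite ltr_pdivrMr// ler_pdivlMr// mulrC.
  by rewrite ltr_pdivrMr// ler_pdivlMr// mulrC.
rewrite !lebesgue_measure_itv/= !lte_fin ltr_pM2r ?invr_gt0//.
case: ifPn => _; last by rewrite mule0.
by rewrite -EFinM; congr (_%:E); field; rewrite gt_eqF.
Qed.

Lemma normal_pdfZ (R : realType) (m s k x : R) : 0 < k -> s != 0 ->
  normal_pdf (k * m) (k * s) (k * x) = normal_pdf m s x / k.
Proof.
move=> k0 s0; have kn0 : k != 0 by rewrite gt_eqF.
rewrite !normal_pdfE ?mulf_neq0//.
have -> : normal_peak (k * s) = normal_peak s / k.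
  rewrite /normal_peak exprMn -mulrA -mulrnAr sqrtrM ?sqr_ge0//.
  by rewrite sqrtr_sqr gtr0_norm// invfM mulrC.
have -> : normal_fun (k * m) (k * s) (k * x) = normal_fun m s x.
  rewrite /normal_fun -mulrBr !exprMn -mulrnAr; congr expR.
  by rewrite -mulrN -mulf_div divff ?mul1r// expf_eq0.
by rewrite mulrAC.
Qed.

Lemma normal_probZ (R : realType) (m s k : R) (A : set (measurableTypeR R)) :
  0 < k -> s != 0 -> measurable A ->
  normal_prob (k * m) (k * s) A = normal_prob m s ((fun x => k * x) @^-1` A).
Proof.
move=> k0 s0 mA; rewrite /normal_prob.
pose phi (x : measurableTypeR R) : measurableTypeR R := k * x.
have mphi : measurable_fun setT phi by exact: mulrl_measurable.
have mf : measurable_fun A (fun x => (normal_pdf (k * m) (k * s) x)%:E).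
  by apply/measurable_EFinP/measurable_funTS; exact: measurable_normal_pdf.
have f0 x : (0 <= (normal_pdf (k * m) (k * s) x)%:E)%E.
  by rewrite lee_fin normal_pdf_ge0.
rewrite (@eq_measure_integral _ _ _ _
  (mscale (NngNum (ltW k0)) (pushforward lebesgue_measure phi))); last first.
  by move=> B mB _; exact: lebesgue_measureZ.
rewrite ge0_integral_mscale// ge0_integral_pushforward//= -ge0_integralZl//=.
- apply: eq_integral => x _; rewrite normal_pdfZ// -EFinM; congr (_%:E).
  by field; rewrite gt_eqF.
- by rewrite -[_ @^-1` _]setTI; exact: mphi.
- apply/measurable_EFinP/measurable_funTS/measurableT_comp => //.
  exact: measurable_normal_pdf.
- by rewrite lee_fin ltW.
Qed.

Lemma normal_prob_normr (R : realType) (m s : R) :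
  normal_prob m `|s| = normal_prob m s.
Proof.
apply/funext => A; apply: eq_integral => x _.
by rewrite /normal_pdf /normal_peak /normal_fun normr_eq0 !real_normK ?num_real.
Qed.

Lemma ge0_integral_normal_prob (R : realType) (m s : R) (f : R -> \bar R) :
  (forall x, 0 <= f x)%E -> measurable_fun setT f ->
  (\int[normal_prob m s]_x f x =
   \int[lebesgue_measure]_x (f x * (normal_pdf m s x)%:E))%E.
Proof.
move=> f0 mf; have dom := normal_prob_dominates m s.
rewrite -(Radon_Nikodym_SigmaFinite.change_of_variables dom)//=.
have mg := measurable_int _ (Radon_Nikodym_SigmaFinite.f_integrable dom).
have mpdf : measurable_fun setT (fun x => (normal_pdf m s x)%:E).
  by apply/measurable_EFinP; exact: measurable_normal_pdf.
apply: ae_eq_integral => //=; [exact: emeasurable_funM..|].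
apply: ae_eqe_mul2l; apply: integral_ae_eq => //=.
- exact: Radon_Nikodym_SigmaFinite.f_integrable.
- by move=> E _ mE; rewrite -(Radon_Nikodym_SigmaFinite.f_integral dom mE).
Qed.

Lemma expR_normal_pdf (R : realType) (m s t x : R) : s != 0 ->
  expR (t * x) * normal_pdf m s x =
  expR (m * t + s ^+ 2 * t ^+ 2 / 2) * normal_pdf (m + s ^+ 2 * t) s x.
Proof.
move=> s0; rewrite !normal_pdfE// /normal_fun ![_ * (normal_peak s * _)]mulrCA.
congr (_ * _); rewrite -!expRD; congr expR.
by rewrite -[s ^+ 2 *+ 2]mulr_natr; field; rewrite s0.
Qed.

Lemma normal_mmt_gen_fun (R : realType) (m s t : R) : s != 0 ->
  'M_(normal_prob m s) idfun t = (expR (m * t + s ^+ 2 * t ^+ 2 / 2))%:E.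
Proof.
move=> s0; rewrite /mmt_gen_fun unlock ge0_integral_normal_prob; last 2 first.
- by move=> x; rewrite lee_fin expR_ge0.
- by apply/measurable_EFinP/measurableT_comp => //; exact: mulrr_measurable.
under eq_integral do rewrite -EFinM /= [_ * t]mulrC expR_normal_pdf// EFinM.
rewrite ge0_integralZl ?integral_normal_pdf ?mule1//.
- by apply/measurable_EFinP; exact: measurable_normal_pdf.
- by move=> x _; rewrite lee_fin normal_pdf_ge0.
Qed.

Lemma normal_prob_set1 (R : realType) (m s x : R) :
  normal_prob m s [set x] = 0%E.
Proof.
have /null_content_dominatesP := normal_prob_dominates m s; apply => //.
exact: lebesgue_measure_set1.
Qed.

Lemma normr_exprn_le_expR (R : realType) (k : nat) (x : R) :
  `|x| ^+ k <= k`!%:R * (expR x + expR (- x)).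
Proof.
have expR_normr_le : expR `|x| <= expR x + expR (- x).
  by have [_|_] := ger0P x; rewrite ?lerDl ?lerDr expR_ge0.
rewrite -ler_pdivrMl ?ltr0n ?fact_gt0// mulrC.
apply: le_trans expR_normr_le; case: k => [|k].
  by rewrite expr0 fact0 divr1 -expR0 ler_expR.
by apply: le_trans (expR_ge1Dxn k (normr_ge0 x)); rewrite lerDr.
Qed.

Lemma normal_absolute_moment_lty (R : realType) (m s : R) (k : nat) : s != 0 ->
  ('E_(normal_prob m s)[(fun x => `|x| ^+ k)%R] < +oo)%E.
Proof.
move=> s0; pose M t := expR \o (t \o* @idfun R).
have M1 t : M t \in Lfun (normal_prob m s) 1.
  apply/Lfun1_integrable/integrableP; split.
    by apply/measurable_EFinP/measurableT_comp => //; exact: mulrr_measurable.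
  under eq_integral do rewrite /= ger0_norm ?expR_ge0//.
  have := normal_mmt_gen_fun m t s0; rewrite /mmt_gen_fun unlock => ->.
  exact: ltry.
have mk : measurable_fun [set: R] (fun x => `|x| ^+ k).
  by apply: measurable_funX; exact: normr_measurable.
apply: (@le_lt_trans _ _ (k`!%:R%:E * 'E_(normal_prob m s)[M 1%R] +
    k`!%:R%:E * 'E_(normal_prob m s)[M (- 1)%R])%E).
  apply: le_expectation_lincomb => // x; rewrite -mulrDr /M /= mulr1 mulrN1.
  exact: normr_exprn_le_expR.
rewrite /M -!/('M_(normal_prob m s) idfun _) !normal_mmt_gen_fun//.
exact: ltry.
Qed.

(* The carrier of [normal_prob] is [measurableTypeR R], which has the same
   measurable sets as [R] but is not convertible to it as a measurable type. *)
Lemma measurable_fun_measurableTypeR_id (R : realType) :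
  @measurable_fun _ _ (measurableTypeR R) R setT idfun.
Proof. exact: measurable_id. Qed.

Definition normal_law (R : realType) (m s : R) : probability R R :=
  @distribution _ _ (measurableTypeR R) R R (normal_prob m s)
    (@mfun_Sub _ _ (measurableTypeR R) R idfun
      (mem_set (@measurable_fun_measurableTypeR_id R))).

Lemma normal_law_exprn_Lfun2 (R : realType) (m s : R) (k : nat) : s != 0 ->
  (fun x => x ^+ k) \in Lfun (normal_law m s) 2%:E.
Proof.
move=> s0; apply: expectation_sqr_lty_Lfun2; first exact: measurable_funX.
have := normal_absolute_moment_lty m (2 * k) s0.
rewrite unlock ge0_integral_distribution; last 2 first.
- by apply/measurable_EFinP/measurable_funX/measurable_funX.
- by move=> x; rewrite lee_fin sqr_ge0.
under eq_integral do rewrite exprM real_normK ?num_real// exprAC.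
exact.
Qed.

Lemma isotropic_gaussian_standardize (R : realType) d (T : measurableType d)
    (P : probability T R) (n : nat) (c : R) (X : 'I_n -> {RV P >-> R}) :
  c != 0 -> isotropic_gaussian c X ->
  iid_law P (normal_law 0 1) (fun i w => `|c|^-1 * X i w).
Proof.
rewrite -normr_eq0 => c0 gaussX.
apply: (@iid_law_comp _ _ _ _ _ (measurableTypeR R) R P (normal_prob 0 c) _
  ( *%R `|c|^-1) _ _ _ _ gaussX) => [|B mB]; first exact: mulrl_measurable.
transitivity (normal_prob (`|c|^-1 * 0) (`|c|^-1 * `|c|) B).
  by rewrite mulr0 mulVf.
by rewrite normal_probZ ?normal_prob_normr// invr_gt0 lt_neqAle eq_sym c0/=.
Qed.

Theorem theorem2 (R : realType) :
  exists C : R, 0 < C /\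
  forall (n : nat) (c : R) (d : measure_display) (T : measurableType d)
         (P : probability T R) (X : 'I_n -> {RV P >-> R}),
    (1 <= n)%N -> c != 0 ->
    @isotropic_gaussian R d T P n c X ->
    let l1h := normalized P (ell1 (fun i => X i : T -> R)) in
    let l2h := normalized P (ell2 (fun i => X i : T -> R)) in
    (maxe ('V_P[(fun w => l2h w / l1h w)%R]) ('V_P[(fun w => l1h w / l2h w)%R])
      <= (C / n%:R)%:E)%E.
Proof.
have [C [C_gt0 variance_le]] := iid_variance_normalized_ratio_le
  (normal_law_exprn_Lfun2 0 2 (oner_neq0 R))
  (normal_prob_set1 0 1 0 : normal_law 0 1 _ = _).
exists C; split=> // n c d T P X n_gt0 c_neq0 gaussX.
have Y_law := isotropic_gaussian_standardize c_neq0 gaussX.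
have mX i : measurable_fun setT (X i : T -> R) by [].
have mY i : measurable_fun setT (fun w => `|c|^-1 * X i w).
  exact: measurable_funM.
have k_neq0 : `|c|^-1 != 0 by rewrite invr_eq0 normr_eq0.
have := variance_le n d T P _ n_gt0 mY Y_law.
by rewrite normalized_ell1Z ?normalized_ell2Z.
Qed.
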